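(* Let $\mathcal{X}$ be an arbitrary domain, $\mathcal{H}\subseteq\{0,1\}^{\mathcal{X}}$ a concept class, and $m\in\mathbb{N}$. Let $\omega^\star_m$ and $\chi^\star_m$ denote the fractional clique and fractional chromatic numbers of $G_m(\mathcal{H})$. Then $\omega^\star_m=\chi^\star_m\le 2^m$. Moreover, the supremum over $\mu$ in the definition of $\chi^\star_m$ is attained, i.e. there is $\mu\in\Delta(\{0,1\}^{\mathcal{X}})$ with $\inf_{\nu\in\Delta(V_m^{\mathcal{H}})}\mathbb{E}_{h\sim\mu,S\sim\nu}[\mathbb{1}[h\text{ consistent with }S]]=1/\chi^\star_m$.
   Context: A dataset of size $m$ is $S=((x_1,y_1),\dots,(x_m,y_m))\in(\mathcal{X}\times\{0,1\})^m$; $h\in\{0,1\}^{\mathcal{X}}$ is consistent with $S$ if $h(x_i)=y_i$ for all $i$; $S$ is $\mathcal{H}$-realizable if some $h\in\mathcal{H}$ is consistent with it; $V_m(\mathcal{H})$ is the set of realizable datasets of size $m$; $G_m(\mathcal{H})$ is the graph on $V_m(\mathcal{H})$ with $S,S'$ adjacent iff there is $x$ with $(x,0)$ appearing in $S$ and $(x,1)$ appearing in $S'$. Equip $\{0,1\}^{\mathcal{X}}$ with the product topology (of discrete $\{0,1\}$) and let $\Delta(\{0,1\}^{\mathcal{X}})$ be the set of regular Borel probability measures on it; let $\Delta(V_m^{\mathcal{H}})$ be the set of finitely supported probability distributions on $V_m(\mathcal{H})$. Define $\frac{1}{\chi^\star_m}=\sup_{\mu\in\Delta(\{0,1\}^{\mathcal{X}})}\inf_{\nu\in\Delta(V_m^{\mathcal{H}})}\mathbb{E}_{h\sim\mu,S\sim\nu}[\mathbb{1}[h\text{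 consistent with }S]]$ and $\frac{1}{\omega^\star_m}=\inf_{\nu\in\Delta(V_m^{\mathcal{H}})}\sup_{\mu\in\Delta(\{0,1\}^{\mathcal{X}})}\mathbb{E}_{h\sim\mu,S\sim\nu}[\mathbb{1}[h\text{ consistent with }S]]$, with conventions $1/0=\infty$, $1/\infty=0$. (This $\omega^\star_m$ coincides with the supremum of $\sum_v\delta(v)$ over fractional cliques $\delta:V_m(\mathcal{H})\to[0,\infty)$, i.e. functions with $\sum_{v\in I}\delta(v)\le1$ for every independent set $I$.) *)

(* Defs.v *)
From HB Require Import structures.
From mathcomp Require Import all_boot all_order all_algebra.
From mathcomp Require Import all_classical all_reals all_analysis.
Set Implicit Arguments. Unset Strict Implicit. Unset Printing Implicit Defensive.
Import Order.TTheory GRing.Theory Num.Theory.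
Local Open Scope classical_set_scope.
Local Open Scope ring_scope.

Definition hyp_space (X : Type) := {ptws X -> bool}.

Definition borel_hyp (X : Type) := g_sigma_algebraType (@open (hyp_space X)).

Definition dataset (X : Type) (m : nat) := {classic ('I_m -> (X * bool)%type)}.

Definition consistent (X : Type) (m : nat) (h : X -> bool) (S : dataset X m) : Prop :=
  forall i : 'I_m, h (S i).1 = (S i).2.

Definition realizable (X : Type) (H : set (X -> bool)) (m : nat) (S : dataset X m) : Prop :=
  exists2 h, H h & consistent h S.

Definition Vm (X : Type) (H : set (X -> bool)) (m : nat) : set (dataset X m) :=
  [set S | realizable H S].
Arguments Vm {X} H m _.

Definition Gm_adj (X : Type) (H : set (X -> bool)) (m : nat) (S S' : dataset X m) : Prop :=
  Vm H m S /\ Vm H m S' /\ exists x, (exists i, S i = (x, false)) /\ (exists j, S' j = (x, true)).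

Definition support (X : Type) (m : nat) (R : realType) (nu : dataset X m -> R) :=
  [set S | nu S != 0].

Definition fin_dist (X : Type) (H : set (X -> bool)) (m : nat) (R : realType)
  (nu : dataset X m -> R) : Prop :=
  [/\ forall S, 0 <= nu S,
      finite_set (support nu),
      support nu `<=` Vm H m &
      (\sum_(S \in support nu) nu S = 1)%R].
Arguments fin_dist {X} H m {R} nu.

Definition regular_measure (X : Type) (R : realType)
  (mu : probability (borel_hyp X) R) : Prop :=
  forall A : set (borel_hyp X), measurable A ->
    mu A = ereal_sup [set mu K | K in [set K : set (hyp_space X) | compact K /\ K `<=` A]]
    /\ mu A = ereal_inf [set mu U | U in [set U : set (hyp_space X) | open U /\ A `<=` U]].

Definition cyl (X : Type) (m : nat) (S : dataset X m) : set (borel_hyp X) :=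
  [set h | consistent h S].

Definition payoff (X : Type) (m : nat) (R : realType)
  (mu : probability (borel_hyp X) R) (nu : dataset X m -> R) : \bar R :=
  (\sum_(S \in support nu) (nu S)%:E * mu (cyl S))%E.

Definition inv_chi_star (X : Type) (H : set (X -> bool)) (m : nat) (R : realType) : \bar R :=
  ereal_sup [set ereal_inf [set payoff mu nu | nu in [set nu | fin_dist H m nu]]
            | mu in [set mu : probability (borel_hyp X) R | regular_measure mu]].

Definition inv_omega_star (X : Type) (H : set (X -> bool)) (m : nat) (R : realType) : \bar R :=
  ereal_inf [set ereal_sup [set payoff mu nu
                           | mu in [set mu : probability (borel_hyp X) R | regular_measure mu]]
            | nu in [set nu : dataset X m -> R | fin_dist H m nu]].

(* Reciprocal on [0, +oo] with 1/0 = +oo and 1/+oo = 0. *)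
Definition einv (R : realType) (x : \bar R) : \bar R :=
  match x with
  | EFin r => if r == 0 then +oo%E else (r^-1)%:E
  | +oo%E => 0%E
  | -oo%E => 0%E
  end.

Definition chi_star (X : Type) (H : set (X -> bool)) (m : nat) (R : realType) : \bar R :=
  einv (inv_chi_star H m R).
Arguments inv_chi_star {X} H m R.
Arguments chi_star {X} H m R.
Definition omega_star (X : Type) (H : set (X -> bool)) (m : nat) (R : realType) : \bar R :=
  einv (inv_omega_star H m R).
Arguments inv_omega_star {X} H m R.
Arguments omega_star {X} H m R.

(* Main.v *)
(** Let [v] be the value of the game in which one player picks a finitely
supported distribution on realizable datasets and the other a single hypothesis.
Integrating over [h] shows [1/omega* <= v], and weak duality gives
[1/chi* <= 1/omega*], so it suffices to find a regular measure giving mass at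
least [v] to the cylinder of every realizable dataset. For finitely many
datasets, and up to [e], Blackwell's approachability argument produces an
empirical measure that does this. Tychonoff's theorem on functions from sets of
hypotheses to [[0, 1]] turns these into one finitely additive probability
defined on all subsets. The hypothesis space is compact, Hausdorff and
zero-dimensional, so the values of this charge on clopen sets extend, by an
outer measure built from open sets, to a regular Borel probability; the product
sigma-algebra would be too small when [X] is uncountable. Finally [v >= 2^-m]
because a uniformly random labelling is consistent with a realizable dataset
with probability at least [2^-m]. *)
Require Import Defs.
From HB Require Import structures.
From mathcomp Require Import all_boot all_order all_algebra.
From mathcomp Require Import finmap.
From mathcomp Require Import all_classical all_reals all_analysis.
From mathcomp Require Import measurable_realfun lra ring.
Set Implicit Arguments. Unset Strict Implicit. Unset Printing Implicit Defensive.
Import Order.TTheory GRing.Theory Num.Theory.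
Import numFieldNormedType.Exports.
Local Open Scope classical_set_scope.
Local Open Scope ring_scope.

(** * Finitely additive probabilities on a power set *)

Definition fa_prob (R : realType) (T : Type) (lam : set T -> R) : Prop :=
  [/\ forall A, 0 <= lam A, lam setT = 1 &
      forall A B, A `&` B = set0 -> lam (A `|` B) = lam A + lam B].

Section FiniteAdditivity.
Context (R : realType) (T : Type) (lam : set T -> R) (lamP : fa_prob lam).

Lemma fa_prob_ge0 A : 0 <= lam A. Proof. by case: lamP. Qed.

Lemma fa_probT : lam setT = 1. Proof. by case: lamP. Qed.

Lemma fa_probID A E : lam A = lam (A `&` E) + lam (A `&` ~` E).
Proof.
case: lamP => _ _ <-; first by rewrite -setIUr setUCr setIT.
by rewrite setIACA setICr setI0.
Qed.

Lemma fa_prob_mono A B : A `<=` B -> lam A <= lam B.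
Proof.
move=> AB; rewrite (fa_probID B A) (setIidr AB).
by rewrite lerDl fa_prob_ge0.
Qed.

Lemma fa_prob0 : lam set0 = 0.
Proof.
have := fa_probID set0 set0; rewrite !set0I => /eqP.
by rewrite addrC -subr_eq subrr eq_sym => /eqP.
Qed.

Lemma fa_prob_le1 A : lam A <= 1.
Proof. by rewrite -fa_probT; exact: fa_prob_mono. Qed.

End FiniteAdditivity.

(** * From charges to regular Borel probabilities on compact zero-dimensional spaces *)

Lemma clopen_between (T : ptopologicalType) (K U : set T) :
  hausdorff_space T -> zero_dimensional T -> compact [set: T] ->
  closed K -> open U -> K `<=` U ->
  exists E, [/\ clopen E, K `<=` E & E `<=` U].
Proof.
move=> hT zT cT cK oU KU.
have : compact K by exact: subclosed_compact cT _.
(* Cover [K] by all clopen subsets of [U]; the union of a finite subcover is the required [E]. *)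
rewrite compact_cover => /(_ _ [set D : set T | clopen D /\ D `<=` U] id).
case=> [i [[]]//| x Kx|D' D'U KD'].
  have /(_ U)[|D [Dx cD DU]] := @zero_dimensional_cvg T x hT zT cT.
    by apply: open_nbhs_nbhs; split => //; exact: KU.
  by exists D.
move: KD'; set E := cover _ _ => KE; exists E; split => //.
- split.
  + by apply: bigcup_open => i /D'U /set_mem[[]].
  + by apply: closed_bigcup => [|i /D'U /set_mem[[]]]; first exact: finite_fset.
- by apply: bigcup_sub => i /D'U /set_mem[].
Qed.

Section StoneExtension.
Local Open Scope ereal_scope.
Context (R : realType) (T : ptopologicalType).
Context (hT : hausdorff_space T) (zT : zero_dimensional T).
Context (cT : compact [set: T]) (lam : set T -> R) (lamP : fa_prob lam).

(** Intended for open [U]: only the clopen values of [lam] enter, and these are the values the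
    measure will keep. *)
Definition inner_content (U : set T) : \bar R :=
  ereal_sup [set (lam C)%:E | C in [set C | clopen C /\ C `<=` U]].

Definition outer_content (A : set T) : \bar R :=
  ereal_inf [set inner_content U | U in [set U | open U /\ A `<=` U]].

Lemma inner_content_ub C U : clopen C -> C `<=` U ->
  (lam C)%:E <= inner_content U.
Proof. by move=> cC CU; apply: ereal_sup_ubound; exists C. Qed.

Lemma inner_content_ge0 U : 0 <= inner_content U.
Proof.
rewrite -[0]/(0%:E) -(fa_prob0 lamP); apply: inner_content_ub => //.
exact: clopen0.
Qed.

Lemma inner_content_le1 U : inner_content U <= 1.
Proof.
by apply: ge_ereal_sup => _ [C _ <-]; rewrite lee_fin; exact: fa_prob_le1.
Qed.

Lemma inner_content_mono U V : U `<=` V -> inner_content U <= inner_content V.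
Proof.
move=> UV; apply: ge_ereal_sup => _ [C [cC CU] <-].
by apply: inner_content_ub => //; exact: subset_trans UV.
Qed.

Lemma inner_content_clopen C : clopen C -> inner_content C = (lam C)%:E.
Proof.
move=> cC; apply/eqP; rewrite eq_le inner_content_ub// andbT.
by apply: ge_ereal_sup => _ [D [_ DC] <-]; rewrite lee_fin; exact: fa_prob_mono.
Qed.

Lemma inner_content_fin_num U : inner_content U \is a fin_num.
Proof.
rewrite ge0_fin_numE ?inner_content_ge0//.
by rewrite (le_lt_trans (inner_content_le1 U))// ltry.
Qed.

(** Induction on [n]: the part of [C] outside the first [n] sets is closed and lies in [U n], so
    some clopen [E] fits between them. Then [C] inside [E] is charged to [U n], and [C] outside [E]
    is covered by the earlier sets. *)
Lemma inner_content_subadditive (U : (set T)^nat) n C :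
  (forall i, open (U i)) -> clopen C ->
  C `<=` \bigcup_(i < n) U i ->
  (lam C)%:E <= \sum_(0 <= i < n) inner_content (U i).
Proof.
move=> oU; elim: n C => [|n IH] C cC CU.
  rewrite big_nil; have -> : C = set0 by rewrite -subset0 => x /CU [].
  by rewrite (fa_prob0 lamP).
have oV : open (\bigcup_(i < n) U i) by exact: bigcup_open.
have [|//|x [Cx nVx]|E [cE KE EU]] :=
    @clopen_between T (C `&` ~` \bigcup_(i < n) U i) (U n) hT zT cT.
- by apply: closedI; [case: cC|exact: open_closedC].
- have [i /= ilt Uix] := CU _ Cx.
  move: ilt; rewrite ltnS leq_eqVlt => /orP[/eqP<-//|ilt].
  by exfalso; apply: nVx; exists i.
rewrite big_nat_recr//= (fa_probID lamP C E) EFinD [leLHS]addeC; apply: leeD.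
  apply: IH; first by apply: clopenI => //; exact: (@clopenC _ _ set0).
  by move=> x [Cx nEx]; apply: contrapT => nVx; apply: nEx; apply: KE.
by apply: inner_content_ub; [exact: clopenI|move=> x [_ /EU]].
Qed.

Lemma inner_content_sigma_subadditive (U : (set T)^nat) :
  (forall i, open (U i)) ->
  inner_content (\bigcup_i U i) <= \sum_(i <oo) inner_content (U i).
Proof.
move=> oU; apply: ge_ereal_sup => _ [C [cC CU] <-].
have : compact C by apply: subclosed_compact cT _ => //; case: cC.
rewrite compact_cover => /(_ _ setT U).
case=> [//|//|D _ CD].
(* Compactness gave a finite subcover; [N] exceeds all its indices, so a partial sum of the series
   suffices. *)
pose N := (\max_(i <- D) i).+1.
apply: (le_trans (@inner_content_subadditive U N C oU cC _)).
  move=> x /CD [i /= iD Uix]; exists i => //=.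
  by rewrite ltnS; exact: leq_bigmax_seq.
by apply: nneseries_lim_ge => *; exact: inner_content_ge0.
Qed.

Lemma outer_content_open U : open U -> outer_content U = inner_content U.
Proof.
move=> oU; apply/eqP; rewrite eq_le; apply/andP; split.
  by apply: ereal_inf_lbound; exists U => //; split.
by apply: le_ereal_inf_tmp => _ [V [_ UV] <-]; exact: inner_content_mono.
Qed.

Lemma outer_content_ge0 A : 0 <= outer_content A.
Proof. by apply: le_ereal_inf_tmp => _ [V _ <-]; exact: inner_content_ge0. Qed.

Lemma outer_content_mono : {homo outer_content : A B / A `<=` B >-> A <= B}.
Proof.
move=> A B AB; apply: le_ereal_inf_tmp => _ [V [oV BV] <-].
by apply: ereal_inf_lbound; exists V => //; split => //; exact: subset_trans BV.
Qed.

Lemma outer_content0 : outer_content set0 = 0.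
Proof.
rewrite outer_content_open; last exact: open0.
by rewrite inner_content_clopen ?(fa_prob0 lamP)//; exact: clopen0.
Qed.

Lemma outer_contentT : outer_content setT = 1.
Proof.
rewrite outer_content_open; last exact: openT.
by rewrite inner_content_clopen ?(fa_probT lamP)//; exact: clopenT.
Qed.

Lemma outer_content_fin_num A : outer_content A \is a fin_num.
Proof.
rewrite ge0_fin_numE ?outer_content_ge0// (@le_lt_trans _ _ 1) ?ltry//.
by rewrite -outer_contentT; exact: outer_content_mono.
Qed.

Lemma outer_content_adherent A (e : R) : (0 < e)%R ->
  exists U, [/\ open U, A `<=` U & inner_content U <= outer_content A + e%:E].
Proof.
move=> e0.
have [_ [U [oU AU] <-] /ltW Ue] := lb_ereal_inf_adherent e0 (outer_content_fin_num A).
by exists U.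
Qed.

Lemma outer_content_sigma_subadditive : sigma_subadditive outer_content.
Proof.
move=> A; apply/lee_addgt0Pr => e e0.
rewrite (le_trans _ (epsilon_trick _ _ (ltW e0)))//; last first.
  by move=> n; exact: outer_content_ge0.
have /choice[U UP] : forall n, exists U, [/\ open U, A n `<=` U &
    inner_content U <= outer_content (A n) + (e / (2 ^ n.+1)%:R)%:E].
  by move=> n; apply: outer_content_adherent; rewrite divr_gt0// ltr0n expn_gt0.
apply: (@le_trans _ _ (inner_content (\bigcup_n U n))).
  apply: ereal_inf_lbound; exists (\bigcup_n U n) => //; split.
    by apply: bigcup_open => i _; case: (UP i).
  by apply: subset_bigcup => i _; case: (UP i).
apply: (le_trans (@inner_content_sigma_subadditive U _)).
  by move=> i; case: (UP i).
apply: lee_nneseries => [n _ _|n _]; first exact: inner_content_ge0.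
by case: (UP n).
Qed.

HB.instance Definition _ := isOuterMeasure.Build R T outer_content
  outer_content0 outer_content_ge0 outer_content_mono
  outer_content_sigma_subadditive.

(* Exhaust [W `&` U] by a clopen [C] and then [W `\` C], still open, by a clopen
   [D]: additivity on the disjoint pair [C], [D] bounds both by [W]. *)
Lemma open_caratheodory U : open U -> outer_content.-caratheodory U.
Proof.
move=> oU; apply: le_caratheodory_measurable => A /=.
apply/lee_addgt0Pr => e e0.
(* One third of [e] for each of the choices of [W], [C] and [D]. *)
have e3 : (0 < e / 3)%R by rewrite divr_gt0.
have [W [oW AW We]] := outer_content_adherent A e3.
have [_ [C [cC CWU] <-] /ltW Ce] :=
  ub_ereal_sup_adherent e3 (inner_content_fin_num (W `&` U)).
have oWC : open (W `&` ~` C).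
  by apply: openI => //; apply: closed_openC; case: cC.
have [_ [D [cD DWC] <-] /ltW De] :=
  ub_ereal_sup_adherent e3 (inner_content_fin_num (W `&` ~` C)).
have CD : (lam C + lam D)%:E <= inner_content W.
  case: (lamP) => _ _ <-; last first.
    by rewrite -subset0 => x [Cx /DWC[]].
  apply: inner_content_ub; first exact: clopenU.
  by move=> x [/CWU[]|/DWC[]].
have AU : outer_content (A `&` U) <= inner_content (W `&` U).
  apply: ereal_inf_lbound; exists (W `&` U) => //; split; first exact: openI.
  by apply: setSI.
have AnU : outer_content (A `&` ~` U) <= inner_content (W `&` ~` C).
  apply: ereal_inf_lbound; exists (W `&` ~` C) => //; split => //.
  by move=> x [Ax nUx]; split; [exact: AW|move=> /CWU[]].
move: Ce De CD AU AnU We.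
rewrite -/(inner_content (W `&` U)) -/(inner_content (W `&` ~` C)).
rewrite -(fineK (inner_content_fin_num (W `&` U))).
rewrite -(fineK (inner_content_fin_num (W `&` ~` C))).
rewrite -(fineK (inner_content_fin_num W)).
rewrite -(fineK (outer_content_fin_num A)).
rewrite -(fineK (outer_content_fin_num (A `&` U))).
rewrite -(fineK (outer_content_fin_num (A `&` ~` U))).
by rewrite -?EFinB -?EFinD !lee_fin; lra.
Qed.

(** The Carathéodory sets form a sigma-algebra, and it contains the open sets. *)
Lemma borel_caratheodory (A : set (g_sigma_algebraType (@open T))) :
  measurable A -> outer_content.-caratheodory A.
Proof.
apply: smallest_sub; last exact: open_caratheodory.
split.
- exact: caratheodory_measurable_set0.
- by move=> B mB; rewrite setTD; exact: caratheodory_measurable_setC.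
- by move=> F mF; exact: caratheodory_measurable_bigcup.
Qed.

Lemma outer_content_sigma_additive :
  semi_sigma_additive
    (outer_content : set (g_sigma_algebraType (@open T)) -> \bar R).
Proof.
move=> F mF tF mUF.
apply: caratheodory_measure_sigma_additive => //.
  by move=> i; exact: borel_caratheodory.
exact: borel_caratheodory.
Qed.

(** Outer regularity is built into [outer_content], which agrees with [inner_content] on open sets.
    Inner regularity follows by complementation, closed sets being compact here. *)
Lemma fa_prob_extension :
  exists mu : probability (g_sigma_algebraType (@open T)) R,
    (forall C, clopen C -> mu C = (lam C)%:E) /\
    forall A : set (g_sigma_algebraType (@open T)), measurable A ->
      mu A = ereal_sup [set mu K | K in [set K : set T | compact K /\ K `<=` A]]
   /\ mu A = ereal_inf [set mu U | U in [set U : set T | open U /\ A `<=` U]].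
Proof.
pose B := g_sigma_algebraType (@open T).
pose m0 : set B -> \bar R := outer_content.
pose m1 := isMeasure.Build _ B R m0 outer_content0 outer_content_ge0
  outer_content_sigma_additive.
pose m2 : measure B R := HB.pack m0 m1.
pose m3 := Measure_isProbability.Build _ B R m2 outer_contentT.
pose mu : probability B R := HB.pack (Measure.sort m2) m3.
have muE A : mu A = outer_content A by [].
have muO U : open U -> mu U = inner_content U by exact: outer_content_open.
have inf_mu (A : set B) :
    mu A = ereal_inf [set mu U | U in [set U : set T | open U /\ A `<=` U]].
  rewrite muE; congr ereal_inf; apply/seteqP.
  by split=> _ [U [oU AU] <-]; exists U => //; rewrite muO.
exists mu; split=> [C cC|A mA].
  by rewrite muO ?inner_content_clopen//; case: cC.
split => //; apply/eqP; rewrite eq_le; apply/andP; split; last first.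
  apply: ge_ereal_sup => _ [K [cK KA] <-].
  exact: outer_content_mono.
apply/lee_addgt0Pr => e e0.
(* The complement of [U] is a compact subset of [A], missing at most [e] of its mass. *)
have [U [oU AU Ue]] := outer_content_adherent (~` A) e0.
have mU : measurable (U : set B) by exact: sub_sigma_algebra.
have muCU : mu (~` U) <=
    ereal_sup [set mu K | K in [set K : set T | compact K /\ K `<=` A]].
  apply: ereal_sup_ubound; exists (~` U) => //; split; last first.
    by move=> x nUx; apply: contrapT => /AU.
  by apply: subclosed_compact cT _ => //; exact: open_closedC.
apply: (le_trans _ (leeD2r _ muCU)).
move: Ue; rewrite -muO// -muE !probability_setC//.
have fU : mu U \is a fin_num by exact: fin_num_measure.
have fA : mu A \is a fin_num by exact: fin_num_measure.
rewrite -(fineK fU) -(fineK fA) -?EFinB -?EFinD !lee_fin; lra.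
Qed.

End StoneExtension.

(** * Empirical measures and Blackwell approachability *)

Definition empirical (R : realType) (T : Type) (hs : seq T) (A : set T) : R :=
  (\sum_(h <- hs) \1_A h) / (size hs)%:R.

Lemma empirical_fa_prob (R : realType) (T : Type) (hs : seq T) :
  (0 < size hs)%N -> fa_prob (@empirical R T hs).
Proof.
move=> s0; split=> [A||A B AB]; rewrite /empirical.
- by rewrite divr_ge0// sumr_ge0// => h _; rewrite indicE.
- under eq_bigr do rewrite indicT.
  by rewrite big_const_seq count_predT iter_addr_0 divff// pnatr_eq0 -lt0n.
- rewrite -mulrDl -big_split; congr (_ / _); apply: eq_bigr => h _ /=.
  rewrite !indicE in_setU.
  case: (boolP (h \in A)) => hA; case: (boolP (h \in B)) => hB;
    rewrite ?addr0 ?add0r//.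
  suff : (A `&` B) h by rewrite AB.
  by split; exact: set_mem.
Qed.

Section Approachability.
Context (R : realType) (I : eqType) (T : Type) (F : seq I) (a : I -> T -> R).
Context (c : R) (a01 : forall i h, 0 <= a i h <= 1).
Context (response : forall w : I -> R, (forall i, 0 <= w i) ->
  exists h, c * \sum_(i <- F) w i <= \sum_(i <- F) w i * a i h).

(* Blackwell's argument: answering the positive part of the current deficit
   keeps its squared norm linear in time. *)
Lemma approach_deficit (t : nat) : exists2 hs : seq T, size hs = t &
  \sum_(i <- F) (Num.max 0 (t%:R * c - \sum_(h <- hs) a i h)) ^+ 2
    <= t%:R * \sum_(i <- F) (`|c| + 1) ^+ 2.
Proof.
elim: t => [|t [hs st IH]].
  exists [::] => //; rewrite [leRHS]mul0r big1// => i _.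
  by rewrite big_nil mul0r subr0 maxxx expr0n.
pose w i := Num.max 0 (t%:R * c - \sum_(h <- hs) a i h).
have w0 i : 0 <= w i by rewrite le_max lexx.
have [h hw] := response w0.
exists (h :: hs); first by rewrite /= st.
have step i : (Num.max 0 (t.+1%:R * c - \sum_(h <- h :: hs) a i h)) ^+ 2 <=
    w i ^+ 2 + 2 * (c * w i - w i * a i h) + (`|c| + 1) ^+ 2.
  have wge : t%:R * c - \sum_(h <- hs) a i h <= w i by rewrite le_max lexx orbT.
  have b1 : (c - a i h) ^+ 2 <= (`|c| + 1) ^+ 2.
    rewrite -[leLHS]real_normK ?num_real//; apply: lerXn2r.
    - by rewrite nnegrE.
    - by rewrite nnegrE addr_ge0.
    rewrite (le_trans (ler_normB _ _))// lerD2l.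
    by have /andP[a0 a1] := a01 i h; rewrite ger0_norm.
  rewrite big_cons -natr1.
  set d := _ - _.
  have dle : d <= w i + (c - a i h) by rewrite /d; move: wge; lra.
  (* Completing the square: the new deficit is at most [w i + (c - a i h)], and the leftover term is
     nonnegative by [b1]. *)
  have -> : w i ^+ 2 + 2 * (c * w i - w i * a i h) + (`|c| + 1) ^+ 2 =
    (w i + (c - a i h)) ^+ 2 + ((`|c| + 1) ^+ 2 - (c - a i h) ^+ 2) by ring.
  rewrite -[leLHS]addr0 lerD ?subr_ge0//.
  have [d0|d0] := leP 0 d; last by rewrite expr0n/= sqr_ge0.
  by rewrite ler_sqr ?nnegrE// (le_trans d0).
apply: (le_trans (ler_sum _ (fun i _ => step i))).
rewrite !big_split/= -[t.+1%:R]natr1 mulrDl mul1r lerD2r -[leRHS]addr0 lerD//.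
(* The choice of the response [h] makes the cross terms sum to at most 0. *)
rewrite -mulr_sumr sumrB -mulr_sumr; move: hw; lra.
Qed.

(** The squared norm of the deficits after [t] rounds is at most [t * K], so each deficit is at most
    [t * e] once [t * e^2] reaches [K]; dividing by [t] leaves an error [e]. *)
Lemma approachability (e : R) : 0 < e -> exists2 hs : seq T,
  (0 < size hs)%N &
  forall i, i \in F -> c - e <= (\sum_(h <- hs) a i h) / (size hs)%:R.
Proof.
move=> e0; set K := \sum_(i <- F) (`|c| + 1) ^+ 2.
have K0 : 0 <= K by rewrite sumr_ge0// => i _; rewrite sqr_ge0.
(* The successor rounds up and keeps [t] positive even when [K] is 0. *)
pose t := (Num.truncn (K / e ^+ 2)).+1.
have tK : K <= t%:R * e ^+ 2.
  by rewrite -ler_pdivrMr ?exprn_gt0// ltW// truncnS_gt.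
have t0 : 0 < t%:R :> R by rewrite ltr0n.
have [hs st hsK] := approach_deficit t.
exists hs; rewrite st// => i iF.
rewrite ler_pdivlMr//.
have : (Num.max 0 (t%:R * c - \sum_(h <- hs) a i h)) ^+ 2 <= (t%:R * e) ^+ 2.
  rewrite exprMn [X in _ <= X * _]expr2 -mulrA.
  apply: le_trans (ler_wpM2l (ltW t0) tK); apply: le_trans hsK.
  rewrite (big_rem i)//= lerDl sumr_ge0// => j _; exact: sqr_ge0.
rewrite ler_sqr; last 2 first.
- by rewrite nnegrE le_max lexx.
- by rewrite nnegrE mulr_ge0// ltW.
by rewrite ge_max => /andP[_]; lra.
Qed.

End Approachability.

(** * Compactness of the space of charges *)

Lemma continuous_subD (R : realType) (K : topologicalType) (f g k : K -> R) :
  continuous f -> continuous g -> continuous k ->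
  continuous (fun x => f x - (g x + k x)).
Proof.
move=> cf cg ck x; apply: (@cvgB _ R^o); first exact: cf.
by apply: (@cvgD _ R^o); [exact: cg|exact: ck].
Qed.

Section CompactnessOfCharges.
Import ArrowAsProduct.
Context (R : realType) (T : Type) (J : eqType) (D : set J) (E : J -> set T).
Context (v : R).
Context (approx : forall (F : seq J) (e : R), 0 < e ->
  exists2 lam : set T -> R, fa_prob lam &
    forall j, j \in F -> D j -> v - e <= lam (E j)).

(** The approximate solutions for finite lists and tolerances form a filter base in a cube. Being a
    charge and each bound are closed conditions on finitely many coordinates, so they pass to a
    cluster point. *)
Lemma fa_prob_compactness : exists2 lam : set T -> R, fa_prob lam &
  forall j, D j -> v <= lam (E j).
Proof.
pose I := {classic set T}.
pose P := forall i : I, (fun=> R) i.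
pose B (p : seq J * R) : set P := [set lam : P | fa_prob (lam : set T -> R) /\
  forall j, j \in p.1 -> D j -> v - p.2 <= lam (E j)].
pose G := filter_from [set p : seq J * R | 0 < p.2] B.
have GP : ProperFilter G.
  apply: filter_from_proper; last first.
    by move=> [F e] /= /(approx F)[lam lamP le]; exists lam; split.
  apply: filter_from_filter; first by exists ([::], 1) => /=.
  move=> [F e] [F' e'] /= e0 e'0; exists (F ++ F', Num.min e e') => /=.
    by rewrite lt_min e0.
  move=> lam [lamP /= le]; split; split => //= j jF Dj.
    apply: le_trans (le j _ Dj); last by rewrite mem_cat jF.
    by rewrite lerB// ge_min lexx.
  apply: le_trans (le j _ Dj); last by rewrite mem_cat jF orbT.
  by rewrite lerB// ge_min lexx orbT.
have := @tychonoff I (fun=> R) (fun=> `[0, 1]%classic)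
  (fun=> @segment_compact R 0 1).
move=> /(_ G GP)[|lam [lam01 clam]].
  exists ([::], 1) => //= lam [lamP _] A.
  by rewrite /= in_itv/= (fa_prob_ge0 lamP) (fa_prob_le1 lamP).
(* A cluster point lies in every closed set that contains some member of the filter base. *)
have closedG (C : set P) p : closed C -> 0 < p.2 -> B p `<=` C -> C lam.
  move=> cC p0 BC; rewrite closure_id in cC; rewrite cC.
  by move: clam; rewrite clusterE; apply; exists p.
have cproj (A : set T) : continuous (fun f : P => f A).
  exact: (@proj_continuous I (fun=> R) A).
have cpre (f : P -> R) (C : set R) : continuous f -> closed C ->
    closed (f @^-1` C).
  by move=> /continuous_closedP; apply.
exists lam.
  split.
  - move=> A; apply: (closedG [set f : P | 0 <= f A] ([::], 1)) => //.
      exact: (cpre _ [set x : R | 0 <= x] (cproj A) (@closed_ge R 0)).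
    by move=> f [fP _]; exact: fa_prob_ge0 fP A.
  - apply: (closedG [set f : P | f setT = 1] ([::], 1)) => //.
      exact: (cpre _ [set x : R | x = 1] (cproj setT) (@closed_eq R 1)).
    by move=> f [fP _]; exact: fa_probT fP.
  - move=> A A' AA'.
    (* Additivity becomes the vanishing of one continuous function, a closed condition. *)
    suff : lam (A `|` A') - (lam A + lam A') = 0 by move/eqP; rewrite subr_eq0 => /eqP.
    apply: (closedG [set f : P | f (A `|` A') - (f A + f A') = 0] ([::], 1)) => //.
      have cdiff : continuous (fun f : P => f (A `|` A') - (f A + f A')).
        exact: (continuous_subD (cproj _) (cproj A) (cproj A')).
      exact: (cpre _ [set x : R | x = 0] cdiff (@closed_eq R 0)).
    by move=> f [[_ _ fD] _] /=; rewrite fD// subrr.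
move=> j Dj; apply/ler_addgt0Pr => e e0; rewrite -lerBlDr.
apply: (closedG [set f : P | v - e <= f (E j)] ([:: j], e)) => //.
  exact: (cpre _ [set x : R | v - e <= x] (cproj (E j)) (@closed_ge R _)).
by move=> f [_ /(_ j)] /=; rewrite inE eqxx; apply.
Qed.

End CompactnessOfCharges.

(** * Topology of the hypothesis space *)

HB.instance Definition _ (X : Type) (T : X -> ptopologicalType) :=
  Pointed.copy (prod_topology T) (forall x, T x).

Section HypothesisSpace.
Context (X : Type).

Lemma hyp_space_hausdorff : hausdorff_space (hyp_space X).
Proof.
exact: (@hausdorff_product {classic X} (fun=> bool) (fun=> discrete_hausdorff)).
Qed.

Lemma hyp_space_zero_dimensional : zero_dimensional (hyp_space X).
Proof.
exact: (@zero_dimension_prod {classic X} (fun=> bool)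
  (fun=> discrete_zero_dimension)).
Qed.

Lemma hyp_space_compact : compact [set: hyp_space X].
Proof.
have := @tychonoff {classic X} (fun=> bool) (fun=> setT) (fun=> bool_compact).
by congr (compact _); apply/seteqP; split.
Qed.

(** A cylinder is a finite intersection of preimages of points under coordinate projections. *)
Lemma cyl_clopen (m : nat) (S : dataset X m) :
  @clopen (hyp_space X) (cyl S).
Proof.
have cylE : cyl S = \bigcap_(i in [set: 'I_m])
    ((fun h : hyp_space X => h (S i).1) @^-1` [set (S i).2]).
  by apply/seteqP; split=> h /= hS; [move=> i _; exact: hS|move=> i; exact: hS].
have cl i : @clopen (hyp_space X)
    ((fun h : hyp_space X => h (S i).1) @^-1` [set (S i).2]).
  apply: preimage_clopen.
    by split; [exact: discrete_open|exact: discrete_closed].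
  exact: (@proj_continuous {classic X} (fun=> bool) (S i).1).
rewrite cylE; split; last by apply: closed_bigI => i _; case: (cl i).
rewrite -(setCK (\bigcap_(i in _) _)) setC_bigcap; apply: closed_openC.
apply: closed_bigcup => [|i _]; first exact: finite_finset.
by apply: open_closedC; case: (cl i).
Qed.

Lemma measurable_cyl (m : nat) (S : dataset X m) : measurable (cyl S).
Proof. by apply: sub_sigma_algebra; case: (cyl_clopen S). Qed.

End HypothesisSpace.

(** * Random labellings, derandomized by conditional expectations *)

Section Derandomization.
Context (R : realType) (X : Type) (H : set (X -> bool)) (m : nat).
Implicit Types (S : dataset X m) (L : seq {classic X}).

Definition points S : seq {classic X} := [seq (S i).1 | i : 'I_m].

(** [L] lists the points whose labels are still undecided; at [[::]] this is consistency of [g] with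
    [S]. *)
Definition agree_off L (g : X -> bool) S : bool :=
  [forall i, (((S i).1 : {classic X}) \in L) || (g (S i).1 == (S i).2)].

Definition free_weight L S : R :=
  \prod_(x <- L) (if x \in points S then 2^-1 else 1).

Lemma free_weight_ge0 L S : 0 <= free_weight L S.
Proof. by apply: prodr_ge0 => x _; case: ifP => // _; rewrite invr_ge0. Qed.

Lemma indic_cyl S (h : X -> bool) :
  \1_(cyl S) h = (agree_off [::] h S)%:R :> R.
Proof.
rewrite indicE; congr (_ %:R); congr nat_of_bool; apply/idP/forallP => [/set_mem hS i|hS].
  by rewrite in_nil /=; apply/eqP; exact: hS.
by apply/mem_set => i; have := hS i; rewrite in_nil => /eqP.
Qed.

(** Only points of [S] contribute a factor 1/2, and a duplicate-free [L] contains at most [m] of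
    them. *)
Lemma free_weight_ge L S : uniq L -> 2^-1 ^+ m <= free_weight L S.
Proof.
move=> uL; rewrite /free_weight -big_mkcond/= big_const_seq iter_mulr_1.
apply: ler_wiXn2l; rewrite ?invr_ge0// ?invf_le1 ?ler1n//.
rewrite -size_filter.
have -> : m = size (points S) by rewrite size_map size_enum_ord.
apply: uniq_leq_size; first exact: filter_uniq.
by move=> x; rewrite mem_filter => /andP[].
Qed.

(* [free_weight L S] is the probability that a uniform relabelling of [L]
   becomes consistent with [S]; fix the labels one at a time without decreasing
   the conditional expectation of the weight of the consistent datasets. *)
Lemma derandomize (F : seq (dataset X m)) (w : dataset X m -> R) L g :
  (forall S, 0 <= w S) -> (forall S, S \in F -> Vm H m S) ->
  exists h, \sum_(S <- F) w S * ((agree_off L g S)%:R * free_weight L S) <=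
            \sum_(S <- F) w S * (agree_off [::] h S)%:R.
Proof.
move=> w0 FV; elim: L g => [|x L IH] g.
  by exists g; apply: ler_sum => S _; rewrite /free_weight big_nil mulr1.
pose gb (b : bool) (y : X) := if (y : {classic X}) == x then b else g y.
(* Averaging over the label of [x]. If [x] occurs in [S], realizability by [h0] makes [h0 x] a label
   that keeps [S] alive, with its weight doubled; otherwise both labels keep [S] alive with its
   weight unchanged. *)
have half_le S : Vm H m S ->
    2 * ((agree_off (x :: L) g S)%:R * free_weight (x :: L) S) <=
    (agree_off L (gb true) S)%:R * free_weight L S +
    (agree_off L (gb false) S)%:R * free_weight L S.
  move=> [h0 _ h0S].
  have term0 b : 0 <= (agree_off L (gb b) S)%:R * free_weight L S.
    by rewrite mulr_ge0// free_weight_ge0.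
  case: (boolP (agree_off (x :: L) g S)) => [/forallP ag|_]; last first.
    by rewrite mul0r mulr0 addr_ge0.
  rewrite mul1r [X in 2 * X]big_cons -/(free_weight L S).
  case: ifPn => [xS|xS].
    have agb : agree_off L (gb (h0 x)) S.
      apply/forallP => i; have := ag i; rewrite inE /gb.
      case: eqP => [e _|_ //].
      by rewrite -(h0S i) e eqxx orbT.
    rewrite mulrA divff ?pnatr_eq0// mul1r.
    case: (h0 x) agb => -> ; rewrite mul1r ?lerDl ?lerDr//.
  have agb b : agree_off L (gb b) S.
    apply/forallP => i; have := ag i; rewrite inE /gb.
    case: eqP => [e|_ //].
    by move: xS; rewrite -e map_f ?mem_enum.
  by rewrite !agb !mul1r; lra.
have [ht htP] := IH (gb true); have [hf hfP] := IH (gb false).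
have sum_le : 2 * \sum_(S <- F) w S * ((agree_off (x :: L) g S)%:R * free_weight (x :: L) S) <=
    \sum_(S <- F) w S * (agree_off [::] ht S)%:R +
    \sum_(S <- F) w S * (agree_off [::] hf S)%:R.
  apply: le_trans (lerD htP hfP); rewrite -big_split mulr_sumr.
  rewrite big_seq [leRHS]big_seq; apply: ler_sum => S SF /=.
  by rewrite mulrCA -mulrDr ler_wpM2l// half_le//; exact: FV.
(* The better of the two labels does at least as well as their average. *)
have [tf|/ltW ft] := leP (\sum_(S <- F) w S * (agree_off [::] ht S)%:R)
                   (\sum_(S <- F) w S * (agree_off [::] hf S)%:R).
  by exists hf; move: sum_le tf; lra.
by exists ht; move: sum_le ft; lra.
Qed.

Lemma consistent_weight_ge (F : seq (dataset X m)) (w : dataset X m -> R) :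
  (forall S, 0 <= w S) -> (forall S, S \in F -> Vm H m S) ->
  exists h, 2^-1 ^+ m * \sum_(S <- F) w S <= \sum_(S <- F) w S * \1_(cyl S) h.
Proof.
(* With every point of every dataset undecided at the start, [agree_off L] holds vacuously and each
   dataset has weight at least [2^-m]. *)
move=> w0 FV; pose L := undup (flatten (map points F)).
have [h hP] := @derandomize F w L (fun=> false) w0 FV; exists h.
under [leRHS]eq_bigr do rewrite indic_cyl.
apply: le_trans hP; rewrite mulr_sumr big_seq [leRHS]big_seq.
apply: ler_sum => S SF; rewrite mulrC ler_wpM2l//.
have -> : agree_off L (fun=> false) S.
  apply/forallP => i; rewrite mem_undup; apply/orP; left.
  by apply/flattenP; exists (points S); rewrite ?map_f ?mem_enum.
by rewrite mul1r free_weight_ge// undup_uniq.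
Qed.

End Derandomization.

(** * The game value and its optimal measure *)

Section Game.
Context (R : realType) (X : Type) (H : set (X -> bool)) (m : nat).
Implicit Types (nu : dataset X m -> R) (h : X -> bool).

Definition success nu h : R := \sum_(S \in Defs.support nu) nu S * \1_(cyl S) h.

(** Collecting upper bounds replaces a supremum over [h]; the infimum of this set is the game value
    [v]. *)
Definition success_bounds : set R :=
  [set c | exists2 nu, fin_dist H m nu & forall h, success nu h <= c].

Lemma success_le1 nu h : fin_dist H m nu -> success nu h <= 1.
Proof.
move=> [nu0 fnu _ nu1]; rewrite -nu1 /success !fsbig_finite//.
by apply: ler_sum => S _; rewrite ler_piMr// indicE; case: (_ \in _).
Qed.

Lemma success_bounds_nonempty nu : fin_dist H m nu -> success_bounds !=set0.
Proof. by move=> dnu; exists 1, nu => // h; exact: success_le1. Qed.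

Lemma success_bounds_lbound : lbound success_bounds (2^-1 ^+ m).
Proof.
move=> c [nu [nu0 fnu nuV nu1] nuc].
have FV S : S \in fset_set (Defs.support nu) -> Vm H m S.
  by rewrite in_fset_set// => /set_mem; exact: nuV.
have [h] := consistent_weight_ge nu0 FV.
rewrite -!fsbig_finite// nu1 mulr1 => /le_trans; apply; exact: nuc.
Qed.

Let v := inf success_bounds.

Lemma has_lbound_success_bounds : has_lbound success_bounds.
Proof. by exists (2^-1 ^+ m); exact: success_bounds_lbound. Qed.

(** If no hypothesis answered [w], normalizing [w] would give a distribution against which every
    hypothesis succeeds with probability at most [c], forcing [v <= c]. *)
Lemma success_response (F : seq (dataset X m)) (c : R) : uniq F ->
  (forall S, S \in F -> Vm H m S) -> c < v ->
  forall w : dataset X m -> R, (forall S, 0 <= w S) ->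
  exists h, c * \sum_(S <- F) w S <= \sum_(S <- F) w S * \1_(cyl S) h.
Proof.
move=> uF FV cv w w0; set W := \sum_(S <- F) w S.
have W0 : 0 <= W by rewrite sumr_ge0.
have [W_eq0|Wneq0] := eqVneq W 0.
  exists (fun=> false); rewrite W_eq0 mulr0 sumr_ge0// => S _.
  by rewrite mulr_ge0// indicE.
apply: contrapT => noresp.
pose nu S : R := if S \in F then w S / W else 0.
have nuF : Defs.support nu `<=` [set` F].
  by move=> S /=; rewrite /nu /Defs.support /=; case: ifP => //; rewrite eqxx.
(* Used with [G] constantly 1 for the total mass and with cylinder indicators for [success]. *)
have nuout (G : dataset X m -> R) :
    \sum_(S \in Defs.support nu) nu S * G S = (\sum_(S <- F) w S * G S) / W.
  rewrite (fsbig_widen _ [set` F])//; last first.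
    by move=> S /= [_ /negP]; rewrite negbK => /eqP ->; rewrite mul0r.
  rewrite -fsbig_seq// mulr_suml big_seq [RHS]big_seq; apply: eq_bigr => S SF.
  by rewrite /nu SF mulrAC.
have dnu : fin_dist H m nu.
  split.
  - by move=> S; rewrite /nu; case: ifP => // _; rewrite divr_ge0.
  - exact: sub_finite_set nuF (finite_seq F).
  - by move=> S /nuF; exact: FV.
  - transitivity (\sum_(S \in Defs.support nu) nu S * 1).
      by apply: eq_fsbigr => S _; rewrite mulr1.
    by rewrite (nuout (fun=> 1)) (eq_bigr w) ?divff// => S _; exact: mulr1.
have : v <= c.
  apply: ge_inf; first exact: has_lbound_success_bounds.
  exists nu => // h; rewrite /success nuout ler_pdivrMr ?lt_def ?Wneq0//.
  by rewrite leNgt; apply/negP => /ltW ?; apply: noresp; exists h.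
by rewrite leNgt cv.
Qed.

Lemma optimal_measure :
  exists2 mu : probability (borel_hyp X) R, regular_measure mu &
    forall S, Vm H m S -> (v%:E <= mu (cyl S))%E.
Proof.
have [F e e0|lam lamP lamV] :=
    @fa_prob_compactness R (hyp_space X) (dataset X m) (Vm H m) (@cyl X m) v.
  pose F' := [seq S <- undup F | `[< Vm H m S >]].
  (* One half of [e] puts the target strictly below [v], as [success_response] requires; the other
     half is the approachability error. *)
  have e2 : 0 < e / 2 by rewrite divr_gt0.
  have [||hs hs0 hsP] := @approachability R _ (hyp_space X) F'
      (fun S h => \1_(cyl S) h) (v - e / 2) _ _ _ e2.
  - by move=> S h; rewrite indicE; case: (_ \in _); rewrite ?lexx ?ler01.
  - apply: success_response; first by rewrite filter_uniq// undup_uniq.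
      by move=> S; rewrite mem_filter => /andP[/asboolP].
    by rewrite ltrBlDr ltrDl.
  exists (empirical R hs); first exact: empirical_fa_prob.
  move=> S SF VS; rewrite (_ : v - e = v - e / 2 - e / 2); last by lra.
  by apply: hsP; rewrite mem_filter mem_undup SF andbT; apply/asboolP.
have [mu [muC muR]] := fa_prob_extension (@hyp_space_hausdorff X)
  (@hyp_space_zero_dimensional X) (@hyp_space_compact X) lamP.
exists mu => // S VS; rewrite muC; last exact: cyl_clopen.
by rewrite lee_fin lamV.
Qed.

Lemma payoff_ge (mu : probability (borel_hyp X) R) nu (c : R) :
  fin_dist H m nu -> (forall S, Vm H m S -> (c%:E <= mu (cyl S))%E) ->
  (c%:E <= payoff mu nu)%E.
Proof.
move=> [nu0 fnu nuV nu1] muc; rewrite /payoff.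
have -> : c%:E = (\sum_(S \in Defs.support nu) (nu S)%:E * c%:E)%E.
  under eq_fsbigr do rewrite -EFinM.
  by rewrite fsumEFin// -mulr_fsuml nu1 mul1r.
apply: lee_fsum => // S Snu; rewrite lee_wpmul2l ?lee_fin//; apply: muc.
exact: nuV.
Qed.

(** Exchanging the finite sum with the integral turns the payoff into the [mu]-integral of
    [success nu], and [mu] has mass 1. *)
Lemma payoff_le (mu : probability (borel_hyp X) R) nu (c : R) :
  fin_dist H m nu -> (forall h, success nu h <= c) ->
  (payoff mu nu <= c%:E)%E.
Proof.
move=> [nu0 fnu nuV nu1] nuc; rewrite /payoff.
have mcyl (S : dataset X m) :
    measurable_fun setT (fun h : borel_hyp X => (\1_(cyl S) h : R)%:E).
  by apply/measurable_EFinP; apply: measurable_indic; exact: measurable_cyl.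
have -> : (\sum_(S \in Defs.support nu) (nu S)%:E * mu (cyl S) =
    \int[mu]_h (\sum_(S \in Defs.support nu) (nu S)%:E * (\1_(cyl S) h)%:E))%E.
  rewrite ge0_integral_fsum//.
  - apply: eq_fsbigr => S _.
    rewrite ge0_integralZl_EFin//.
    by rewrite integral_indic ?setIT//; exact: measurable_cyl.
  - by move=> S; apply: emeasurable_funM; [exact: measurable_cst|exact: mcyl].
  - by move=> S h _; rewrite mule_ge0// lee_fin// indicE.
have -> : c%:E = (\int[mu]_h c%:E)%E :> \bar R.
  by rewrite integral_cst// [X in (_ * X)%E]probability_setT mule1.
apply: ge0_le_integral => //.
- move=> h _; rewrite fsbig_finite// sume_ge0// => S _.
  by rewrite mule_ge0// lee_fin// indicE.
- apply: emeasurable_fsum => // S.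
  by apply: emeasurable_funM; [exact: measurable_cst|exact: mcyl].
- move=> h _; under eq_fsbigr do rewrite -EFinM.
  by rewrite fsumEFin// lee_fin; exact: nuc.
Qed.

Lemma inv_chi_le_inv_omega : (inv_chi_star H m R <= inv_omega_star H m R)%E.
Proof.
apply: le_ereal_inf_tmp => _ [nu dnu <-]; apply: ge_ereal_sup => _ [mu rmu <-].
apply: (@le_trans _ _ (payoff mu nu)).
  by apply: ereal_inf_lbound; exists nu.
by apply: ereal_sup_ubound; exists mu.
Qed.

(** The existence of [nu] makes [success_bounds] nonempty, so its infimum is approached by bounds of
    actual distributions. *)
Lemma inv_omega_le nu : fin_dist H m nu -> (inv_omega_star H m R <= v%:E)%E.
Proof.
move=> dnu; apply/lee_addgt0Pr => e e0.
have [|c [nu' dnu' nuc] cv] := @inf_adherent _ success_bounds _ e0.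
  split; first exact: success_bounds_nonempty dnu.
  exact: has_lbound_success_bounds.
apply: (@le_trans _ _ c%:E); last by rewrite -EFinD lee_fin ltW.
apply: (@le_trans _ _ (ereal_sup [set payoff mu nu' | mu in
    [set mu : probability (borel_hyp X) R | regular_measure mu]])).
  by apply: ereal_inf_lbound; exists nu'.
by apply: ge_ereal_sup => _ [mu _ <-]; exact: payoff_le dnu' nuc.
Qed.

End Game.

(** * Minimax equality, the bound and attainment *)

Theorem mainTheorem6 (R : realType) (X : Type) (H : set (X -> bool)) (m : nat) :
  [/\ omega_star H m R = chi_star H m R,
      (chi_star H m R <= (2 ^+ m)%:E)%E &
      exists2 mu : probability (borel_hyp X) R, regular_measure mu &
        ereal_inf [set payoff mu nu | nu in [set nu | fin_dist H m nu]]
        = inv_chi_star H m R].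
Proof.
have [mu rmu muv] := optimal_measure R H m.
set v := inf (@success_bounds R X H m) in muv.
set g := ereal_inf [set payoff mu nu | nu in [set nu | fin_dist H m nu]].
have g_chi : (g <= inv_chi_star H m R)%E by apply: ereal_sup_ubound; exists mu.
have chi_omega := inv_chi_le_inv_omega R H m.
have [[nu dnu]|none] := pselect (exists nu : dataset X m -> R, fin_dist H m nu).
  have vg : (v%:E <= g)%E.
    by apply: le_ereal_inf_tmp => _ [nu' dnu' <-]; exact: payoff_ge dnu' muv.
  have omega_v : (inv_omega_star H m R <= v%:E)%E := inv_omega_le dnu.
  (* The chain [v <= g <= 1/chi* <= 1/omega* <= v] collapses to equalities. *)
  have chiE : inv_chi_star H m R = v%:E.
    by apply/eqP; rewrite eq_le (le_trans chi_omega)//= (le_trans vg).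
  have omegaE : inv_omega_star H m R = v%:E.
    by apply/eqP; rewrite eq_le omega_v/= -chiE.
  have v_ge : 2^-1 ^+ m <= v.
    apply: lb_le_inf; first exact: success_bounds_nonempty dnu.
    exact: success_bounds_lbound.
  (* Positivity selects the branch [r^-1] of [einv]; inverting [v_ge] then gives the bound [2^m]. *)
  have v_gt0 : 0 < v by apply: lt_le_trans v_ge; rewrite exprn_gt0 ?invr_gt0.
  split.
  - by rewrite /omega_star /chi_star omegaE chiE.
  - rewrite /chi_star chiE /= gt_eqF// lee_fin -[leRHS]invrK -exprVn.
    by rewrite lef_pV2// posrE exprn_gt0 ?invr_gt0.
  - by exists mu => //; apply/eqP; rewrite eq_le g_chi/= chiE.
(* With no distribution available, the infima over [nu] are over the empty set, hence infinite, and
   the convention for 1/oo makes both numbers 0. *)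
have gE : g = +oo%E.
  apply/eqP; rewrite -leye_eq; apply: le_ereal_inf_tmp => y [nu dnu _].
  by exfalso; apply: none; exists nu.
have chiE : inv_chi_star H m R = +oo%E by apply/eqP; rewrite -leye_eq -gE.
have omegaE : inv_omega_star H m R = +oo%E by apply/eqP; rewrite -leye_eq -chiE.
split.
- by rewrite /omega_star /chi_star omegaE chiE.
- by rewrite /chi_star chiE /= lee_fin exprn_ge0.
- by exists mu => //; rewrite chiE.
Qed.
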